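(* For every fixed $\alpha\in(0,1)$, there is a sequence of $\{C_{-3},C_{+6}\}$-free signed graphs $\widehat Q_q^*$, indexed by $q=2^{2j+1}\to\infty$ ($j$ an integer), such that with $N=q^3$, $$v(\widehat Q_q^* )=\left(\frac{1+\alpha}{2}+o(1)\right)N,\qquad e(\widehat Q_q^* )=\left(\frac{1+2\alpha-\alpha^2}{4}+o(1)\right)N^{4/3}.$$ Consequently, $$\limsup_{n\to\infty}\frac{R_6(n)}{n^{4/3}}\ \ge\ 2^{1/3}c_6=0.672633550\ldots,\qquad\text{where}\quad c_6=\frac{3(\sqrt5-2)}{(\sqrt5-1)^{4/3}}=0.533869602\ldots.$$
   Context: All graphs are finite and simple; $v(\cdot)$, $e(\cdot)$ are the numbers of vertices and edges. A signed graph is a pair $\widehat G=(G,\sigma)$ with $\sigma:E(G)\to\{+1,-1\}$; the sign of a cycle is the product of its edge signs. A signed graph is $\{C_{-3},C_{+6}\}$-free if it contains no triangle of sign $-1$ and no $6$-cycle of sign $+1$. $R_6(n)=\widehat{\mathrm{ex}}(n,\{C_{-3},C_{+6}\})$ is the maximum number of edges of an $n$-vertex $\{C_{-3},C_{+6}\}$-free signed graph. The $o(1)$ terms tend to $0$ as $q\to\infty$ with $\alpha$ fixed. *)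

(* Defs.v *)
From HB Require Import structures.
From mathcomp Require Import all_boot all_order all_algebra.
From mathcomp Require Import all_classical all_reals all_analysis.

Set Implicit Arguments.
Unset Strict Implicit.
Unset Printing Implicit Defensive.

Import Order.TTheory GRing.Theory Num.Theory.
Import numFieldNormedType.Exports.

Local Open Scope ring_scope.

(* A finite simple graph on T is a set of 2-element subsets of T.  In the pair
   (E, s), [s e = true] means that e is negative; the values of s off E are
   irrelevant. *)
Record signed_graph (T : finType) := SignedGraph {
  sg_val :> {set {set T}} * {ffun {set T} -> bool};
  sg_simple : [forall e in sg_val.1, #|e| == 2]
}.

HB.instance Definition _ (T : finType) := [isSub for @sg_val T].
HB.instance Definition _ (T : finType) := [Finite of signed_graph T by <:].

Section SignedGraph.
Context {T : finType}.
Implicit Types (G : signed_graph T) (c : seq T).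

Definition edges G : {set {set T}} := G.1.

Definition sigma G (e : {set T}) : int := (-1) ^+ G.2 e.

Definition adj G : rel T := fun x y => [set x; y] \in edges G.

Definition num_vertices G : nat := #|T|.

Definition num_edges G : nat := #|edges G|.

Definition cycle_sign G c : int := \prod_(x <- c) sigma G [set x; next c x].

(* For k >= 3, G has a (not necessarily induced) k-cycle of sign s; a k-cycle
   is given by its sequence of k distinct vertices. *)
Definition has_signed_cycle G (k : nat) (s : int) : bool :=
  [exists c : k.-tuple T,
    [&& cycle (adj G) c, uniq c & cycle_sign G c == s]].

Definition C3neg_C6pos_free G : bool :=
  ~~ has_signed_cycle G 3 (-1) && ~~ has_signed_cycle G 6 1.

End SignedGraph.

Definition R6 (n : nat) : nat :=
  \max_(G : signed_graph 'I_n | C3neg_C6pos_free G) num_edges G.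

Definition c6 (R : realType) : R :=
  3 * (Num.sqrt 5 - 2) / (Num.sqrt 5 - 1) `^ (4 / 3).

(* x rounded to nine decimal places is 0.abc, where a, b, c are blocks of three
   decimal digits. *)
Definition rounds_to9 (R : realType) (x : R) (a b c : nat) : Prop :=
  `|x - (a%:R / 10 ^+ 3 + b%:R / 10 ^+ 6 + c%:R / 10 ^+ 9)| < (10 ^+ 9)^-1 / 2.

(* Main.v *)
Require Import Defs.
From mathcomp Require Import all_boot all_order all_algebra all_field.
From mathcomp Require Import all_classical all_reals all_analysis.
From mathcomp Require Import ring lra zify.
Import Order.TTheory GRing.Theory Num.Theory.
Import numFieldNormedType.Exports.
Local Open Scope ring_scope.

(**
For q = 2^(2j+1) the field F of order q has an automorphism tau whose square is
the Frobenius map.  Join (a, b, c) and (x, y, z) in F^3 when c + y = a tau(x)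
and b + z = tau(a) x: this is the affine part of the polarity graph of the
generalized quadrangle W(q), and its closed 6-walks all run inside trees.
Translation by (0, 1, 1) is a fixed-point-free automorphism.  Sign an edge of the
quotient positive if the chosen representatives of its ends are adjacent, and
negative if one of them has to be translated.  A positive closed walk of the
quotient lifts to a closed walk, so the quotient has no positive hexagon, and,
running twice around it, no triangle of either sign.  It has q^3/2 vertices and
about q^4/4 edges.

As in the hexagon construction of Furedi, Naor and Verstraete, double the
vertices whose first coordinate lies in a set A of about alpha q field elements,
keeping only two edges with a common end out of the four that would replace an
edge between doubled vertices.  A positive hexagon would now be the blow-up of a
path with three edges whose two inner vertices are doubled, and it would contain
two disjoint copies of the middle edge.  Each vertex has exactly one neighbour
with any given first coordinate, so a deterministic A already gives the right
edge count, with edges inside a fibre of the first coordinate (among them the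
loops) left out.  The density is optimal at alpha = sqrt 5 - 2.
*)

Set Implicit Arguments.
Unset Strict Implicit.
Unset Printing Implicit Defensive.

(** * Signed graphs from pairs of symmetric relations *)

(** [r false] supplies the positive edges and [r true] the negative ones. The edge count is the
    handshake identity: every edge comes from exactly two ordered pairs. *)
Lemma signed_graph_of_rel (V : finType) (r : bool -> rel V) :
  (forall t, symmetric (r t)) -> (forall t, irreflexive (r t)) ->
  (forall v w, r false v w -> r true v w -> False) ->
  exists G : signed_graph V,
    [/\ forall v w, adj G v w = r false v w || r true v w,
        forall t v w, r t v w -> sigma G [set v; w]%SET = (-1) ^+ t &
        (num_edges G).*2 = (\sum_v \sum_(w | r false v w || r true v w) 1)%N].
Proof.
move=> r_sym r_irr r_disj.
pose r' v w := r false v w || r true v w.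
have r'_sym : symmetric r' by move=> v w; rewrite /r' !(r_sym _ v w).
have r'_irr : irreflexive r' by move=> v; rewrite /r' !r_irr.
pose E : {set {set V}} :=
  [set e : {set V} | [exists v, [exists w, (e == [set v; w]%SET) && r' v w]]]%SET.
pose s : {ffun {set V} -> bool} :=
  [ffun e : {set V} => [exists v, [exists w, (e == [set v; w]%SET) && r true v w]]].
have pair_inj (v w x y : V) : [set v; w]%SET = [set x; y]%SET ->
    v != w -> (v = x /\ w = y) \/ (v = y /\ w = x).
  move=> /setP eq_vw; have := eq_vw v; have := eq_vw w; have := eq_vw x.
  rewrite !inE !eqxx ?orbT /= => /orP xvw /esym wxy /esym vxy vw.
  case/orP: vxy => /eqP ?; case/orP: wxy => /eqP ?; subst.
  - by rewrite eqxx in vw.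
  - by left.
  - by right.
  - by rewrite eqxx in vw.
have E_simple : [forall e in E, #|e| == 2].
  apply/forall_inP => e; rewrite inE => /existsP[v /existsP[w /andP[/eqP-> vw]]].
  have vNw : v != w by apply: contraTneq vw => ->; rewrite r'_irr.
  by rewrite cards2 vNw.
have adjE v w : ([set v; w]%SET \in E) = r' v w.
  rewrite inE; apply/existsP/idP => [[x /existsP[y /andP[/eqP eq_e xy]]]|vw].
    have xNy : x != y by apply: contraTneq xy => ->; rewrite r'_irr.
    by have [[<- <-]//|[<- <-]] := pair_inj _ _ _ _ (esym eq_e) xNy; rewrite r'_sym.
  by exists v; apply/existsP; exists w; rewrite eqxx.
exists (@SignedGraph V (E, s) E_simple); split.
- exact: adjE.
- move=> t v w vw; rewrite /sigma /= ffunE; congr (_ ^+ nat_of_bool _).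
  have vNw : v != w by apply: contraTneq vw => ->; rewrite r_irr.
  apply/existsP/idP => [[x /existsP[y /andP[/eqP eq_e xy]]]|tt].
    have rvw : r true v w.
      by have [[-> ->]//|[-> ->]] := pair_inj _ _ _ _ eq_e vNw; rewrite r_sym.
    by case: t vw => // /r_disj/(_ rvw).
  by rewrite tt in vw; exists v; apply/existsP; exists w; rewrite eqxx.
- rewrite pair_big_dep /=.
  rewrite (partition_big (fun p : V * V => [set p.1; p.2]%SET) (mem E)) /=; last first.
    by move=> [v w] /= vw; rewrite adjE.
  rewrite /num_edges /edges /= -mul2n mulnC -sum_nat_const.
  apply: eq_bigr => e; rewrite inE => /existsP[v /existsP[w /andP[/eqP-> vw]]].
  have vNw : v != w by apply: contraTneq vw => ->; rewrite r'_irr.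
  rewrite (eq_bigl (mem [set (v, w); (w, v)]%SET)).
    by rewrite sum1_card cards2 xpair_eqE negb_and vNw.
  move=> [x y] /=; rewrite !inE !xpair_eqE; apply/andP/orP.
    case=> xy /eqP eq_e.
    have xNy : x != y by apply: contraTneq xy => ->; rewrite -/(r' y y) r'_irr.
    by have [[-> ->]|[-> ->]] := pair_inj _ _ _ _ eq_e xNy; rewrite !eqxx; [left|right].
  case=> /andP[/eqP-> /eqP->]; first by rewrite eqxx.
  by rewrite finset.setUC eqxx -/(r' w v) r'_sym.
Qed.

(** * First coordinates of closed 6-walks in the polarity graph *)

Section Polarity.
Context (F : finFieldType) (tau : F -> F).
Context (F2 : 2 \in [pchar F]).
Context (tauD : {morph tau : x y / x + y}).
Context (tauM : {morph tau : x y / x * y}).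
Context (tauK : forall x, tau (tau x) = x ^+ 2).

Lemma tau0 : tau 0 = 0.
Proof. by apply: (addIr (tau 0)); rewrite -tauD !add0r. Qed.

Lemma tau_eq0 x : tau x = 0 -> x = 0.
Proof.
by move=> tx; have /eqP := tauK x; rewrite tx tau0 eq_sym expf_eq0 => /eqP.
Qed.

Let two0 : (2 : F) = 0. Proof. exact: pcharf0. Qed.

Lemma addr_eq0_pchar2 (x y : F) : x + y = 0 -> x = y.
Proof. by move/eqP; rewrite addr_eq0 oppr_pchar2 // => /eqP. Qed.

Lemma tau_inj : injective tau.
Proof.
move=> x y txy; apply: addr_eq0_pchar2; apply: tau_eq0.
by rewrite tauD txy -mulr2n -mulr_natl two0 mul0r.
Qed.

(** The two hypotheses are what remains of the six pairs of edge equations of a closed 6-walk once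
    the other coordinates cancel. The first two outcomes say that the first coordinates run over a
    star, the last three that they run over a path with three edges whose middle edge is used
    twice. *)
Lemma hexagon_coincidence (a1 a2 a3 a4 a5 a6 : F) :
  a1 * tau a2 + tau a2 * a3 + a3 * tau a4 + tau a4 * a5 + a5 * tau a6
    + tau a6 * a1 = 0 ->
  tau a1 * a2 + a2 * tau a3 + tau a3 * a4 + a4 * tau a5 + tau a5 * a6
    + a6 * tau a1 = 0 ->
  [\/ a1 = a3 /\ a3 = a5, a2 = a4 /\ a4 = a6 |
      [\/ a4 = a6 /\ a1 = a3, a3 = a5 /\ a2 = a6 | a1 = a5 /\ a2 = a4]].
Proof.
move=> e1 e2.
have f1 : (a1 + a3) * tau (a2 + a6) = (a3 + a5) * tau (a4 + a6).
  apply: addr_eq0_pchar2; rewrite !tauD.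
  transitivity (2 * (a3 * tau a6)); last by rewrite two0 mul0r.
  by rewrite -[RHS]addr0 -e1; ring.
have f2 : (a2 + a6) * tau (a1 + a3) = (a4 + a6) * tau (a3 + a5).
  apply: addr_eq0_pchar2; rewrite !tauD.
  transitivity (2 * (tau a3 * a6)); last by rewrite two0 mul0r.
  by rewrite -[RHS]addr0 -e2; ring.
have f3 := congr1 tau f2; rewrite !tauM !tauK in f3.
(* Put x = a1 + a3, y = a3 + a5, p = a2 + a6, r = a4 + a6. Then [f1] reads x tau(p) = y tau(r), and
   [f3] reads tau(p) x^2 = tau(r) y^2. Hence tau(r) y (x + y) = 2 tau(p) x^2 = 0, and x + y = a1 +
   a5. *)
have : tau (a4 + a6) * (a3 + a5) * (a1 + a5) = 0.
  transitivity (tau (a4 + a6) * (a3 + a5) * ((a1 + a3) + (a3 + a5))).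
    rewrite (_ : a1 + a3 + (a3 + a5) = a1 + a5 + 2 * a3); last by ring.
    by rewrite two0 mul0r addr0.
  rewrite mulrDr -[X in _ + X](_ : tau (a4 + a6) * (a3 + a5) ^+ 2 = _); last by ring.
  rewrite -f3 -[X in X * _](mulrC (a3 + a5)) -f1.
  transitivity (2 * (tau (a2 + a6) * (a1 + a3) ^+ 2)); first by ring.
  by rewrite two0 mul0r.
move/eqP; rewrite !mulf_eq0 -orbA => /or3P[] /eqP.
- move=> /tau_eq0 q0; have := f1; rewrite q0 tau0 mulr0 => /eqP.
  rewrite mulf_eq0 => /orP[] /eqP.
    move=> /addr_eq0_pchar2 ?; apply: Or33; apply: Or31; split=> //.
    exact: addr_eq0_pchar2.
  move=> /tau_eq0/addr_eq0_pchar2 ->; apply: Or32; split=> //; last exact: addr_eq0_pchar2.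
  by rewrite (addr_eq0_pchar2 q0).
- move=> y0; have := f1; rewrite y0 mul0r => /eqP; rewrite mulf_eq0 => /orP[] /eqP.
    by move=> /addr_eq0_pchar2 ?; apply: Or31; split=> //; exact: addr_eq0_pchar2.
  move=> /tau_eq0/addr_eq0_pchar2 ?; apply: Or33; apply: Or32; split=> //.
  exact: addr_eq0_pchar2.
- move=> /addr_eq0_pchar2 a15; subst a5; move: f1; rewrite (addrC a3) => /eqP.
  rewrite -subr_eq0 -mulrBr mulf_eq0 subr_eq0 => /orP[] /eqP.
    by move=> /addr_eq0_pchar2 ->; apply: Or31.
  by move=> /tau_inj/addIr ?; apply: Or33; apply: Or33.
Qed.

(** * The quotient by the translation and the doubling of vertices *)

Lemma natrD_addb_pchar2 (t t' : bool) : (t%:R + t'%:R : F) = (t (+) t')%:R.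
Proof. by case: t; case: t' => //=; rewrite ?addr0 ?add0r // -two0. Qed.

(** Selects one element of each coset of {0, 1}. *)
Definition below_succ (c : F) : bool := (enum_rank c < enum_rank (c + 1)%R)%N.

Lemma below_succ1 c : below_succ (c + 1) = ~~ below_succ c.
Proof.
rewrite /below_succ -addrA -[1 + 1]/(2 : F) two0 addr0 -leqNgt [RHS]leq_eqVlt.
case: eqP => // e; have /eqP := enum_rank_inj (val_inj e).
by rewrite -{2}(addr0 c) (inj_eq (addrI c)) oner_eq0.
Qed.

Lemma below_succ_bool c (t : bool) : below_succ (c + t%:R) = t (+) below_succ c.
Proof. by case: t; rewrite ?addr0 // below_succ1. Qed.

(** Restricting the last coordinate to these values selects one representative from each orbit of
    the translation by (0, 1, 1). *)
Definition half := {c : F | below_succ c}.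

Lemma card_half : (#|{: half}|.*2 = #|F|)%N.
Proof.
rewrite card_sig -addnn -(cardC below_succ); congr addn.
rewrite -(fintype.card_image (addIr (1 : F)) below_succ).
apply/esym/eq_card => c; rewrite [LHS]inE; apply/idP/fintype.imageP => [cS|[d dS ->]].
  exists (c + 1); first exact: etrans (below_succ1 c) cS.
  by rewrite -addrA -[1 + 1]/(2 : F) two0 addr0.
by apply: etrans (congr1 negb (below_succ1 d)) _; rewrite negbK; exact: dS.
Qed.

Context (A : {set F}).

Definition copy := {p : F * bool | p.2 ==> (p.1 \in A)}.

(** [(a, true)] is the second copy of [a].  Over two doubled first coordinates the
    copy [(a, false)] of the smaller one is the centre of the two retained edges. *)
Definition copy_rel (p r : F * bool) : bool := (p.1 != r.1) &&
  (if enum_rank p.1 < enum_rank r.1 then ~~ p.2 || (r.1 \notin A)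
   else ~~ r.2 || (p.1 \notin A))%N.

Lemma copy_rel_sym : symmetric copy_rel.
Proof.
move=> p r; rewrite /copy_rel eq_sym; case: eqVneq => //= rNp.
case: ltngtP => // e; have eq_rp := enum_rank_inj (val_inj e).
by rewrite eq_rp eqxx in rNp.
Qed.

Definition vert := (copy * F * half)%type.

Implicit Types u v w : vert.

Definition xc v : F := (val v.1.1).1.
Definition ix v : bool := (val v.1.1).2.
Definition yc v : F := v.1.2.
Definition zc v : F := val v.2.

(** [t] tells whether one end has to be translated by (0, 1, 1), that is, whether
    the edge is negative. *)
Definition inc (t : bool) : rel vert := fun v w =>
  [&& copy_rel (val v.1.1) (val w.1.1),
      zc v + yc w == xc v * tau (xc w) + t%:R &
      yc v + zc w == tau (xc v) * xc w + t%:R].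

Lemma incP t v w : inc t v w ->
  [/\ copy_rel (val v.1.1) (val w.1.1),
      xc v * tau (xc w) = zc v + yc w - t%:R &
      tau (xc v) * xc w = yc v + zc w - t%:R].
Proof. by case/and3P=> ? /eqP-> /eqP->; rewrite !addrK. Qed.

Lemma inc_sym t : symmetric (inc t).
Proof.
move=> v w; rewrite /inc copy_rel_sym; congr andb; rewrite andbC.
by congr andb; rewrite addrC mulrC.
Qed.

Lemma inc_irr t : irreflexive (inc t).
Proof. by move=> v; rewrite /inc /copy_rel eqxx. Qed.

Lemma inc_xcN t v w : inc t v w -> xc v <> xc w.
Proof. by case/incP=> /andP[/eqP]. Qed.

Lemma inc_disj v w : inc false v w -> inc true v w -> False.
Proof.
move=> /incP[_ e _] /incP[_ + _]; rewrite e => /addrI/oppr_inj/esym/eqP.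
by rewrite oner_eq0.
Qed.

(** * No triangle and no positive hexagon *)

Lemma vert_eq u w : xc u = xc w -> ix u = ix w -> yc u = yc w -> zc u = zc w ->
  u = w.
Proof.
case: u w => [[p b] c] [[r y] z]; rewrite /xc /ix /yc /zc /= => e1 e2 -> /val_inj->.
congr (_, _, _); apply: val_inj => /=.
by rewrite [sval p]surjective_pairing [sval r]surjective_pairing e1 e2.
Qed.

(** The edge equations fix the last coordinate of a neighbour up to adding 1, membership in [half]
    then fixes the sign, and the sign fixes the second coordinate. So two distinct neighbours of [v]
    over one first coordinate can differ only in their copy. *)
Lemma common_neighbour t t' u v w :
  inc t u v -> inc t' v w -> xc u = xc w -> u <> w -> ix u != ix w.
Proof.
rewrite inc_sym => /and3P[_ /eqP uy /eqP uz] /and3P[_ /eqP wy /eqP wz] xuw uNw.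
apply/eqP => iuw; apply: uNw; rewrite -xuw in wy wz.
have : zc u = zc w + (t (+) t')%:R.
  apply: (addrI (yc v)); rewrite addrA wz uz -addrA natrD_addb_pchar2.
  by case: (t); case: (t').
have : below_succ (zc u) by exact: (valP u.2).
have : below_succ (zc w) by exact: (valP w.2).
move=> sw + zuw; rewrite zuw below_succ_bool sw addbT negb_add => /eqP tt'.
apply: vert_eq => //; last by rewrite zuw tt' addbb addr0.
by apply: (addrI (zc v)); rewrite uy wy tt'.
Qed.

(** Both first coordinates must be doubled, since each occurs with two different copies, and the two
    edges retained there share an end. *)
Lemma no_two_disjoint_copies t t' u u' w w' :
  inc t u w -> inc t' u' w' -> xc u = xc u' -> xc w = xc w' ->
  ix u != ix u' -> ix w != ix w' -> False.
Proof.
move=> /incP[+ _ _] /incP[+ _ _] xu xw.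
have := valP u.1.1; have := valP u'.1.1; have := valP w.1.1; have := valP w'.1.1.
rewrite /copy_rel -!/(xc _) -!/(ix _) xu xw => /=.
case: (xc w' \in A); case: (xc u' \in A); case: ifP => _;
  by case: (ix u); case: (ix u'); case: (ix w); case: (ix w'); rewrite ?andbF.
Qed.

(** Adding alternately the two equations of successive edges, every second and third coordinate that
    occurs does so twice and vanishes in characteristic 2. The translations sum to zero because the
    number of negative edges is even. *)
Lemma closed_walk6 t1 t2 t3 t4 t5 t6 v1 v2 v3 v4 v5 v6 :
  inc t1 v1 v2 -> inc t2 v2 v3 -> inc t3 v3 v4 ->
  inc t4 v4 v5 -> inc t5 v5 v6 -> inc t6 v6 v1 ->
  ~~ odd (t1 + t2 + t3 + t4 + t5 + t6) ->
  let a := xc in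
  [\/ a v1 = a v3 /\ a v3 = a v5, a v2 = a v4 /\ a v4 = a v6 |
      [\/ a v4 = a v6 /\ a v1 = a v3, a v3 = a v5 /\ a v2 = a v6 |
          a v1 = a v5 /\ a v2 = a v4]].
Proof.
move=> /incP[_ e1 f1] /incP[_ e2 f2] /incP[_ e3 f3] /incP[_ e4 f4].
move=> /incP[_ e5 f5] /incP[_ e6 f6] even_t.
have t0 : (t1%:R + t2%:R + t3%:R + t4%:R + t5%:R + t6%:R : F) = 0.
  by rewrite -!natrD -(even_halfK even_t) -mul2n natrM two0 mul0r.
apply: hexagon_coincidence.
- rewrite e1 f2 e3 f4 e5 f6.
  transitivity (2 * (zc v1 + yc v2 + zc v3 + yc v4 + zc v5 + yc v6)
    - (t1%:R + t2%:R + t3%:R + t4%:R + t5%:R + t6%:R)); first by ring.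
  by rewrite t0 two0 mul0r subr0.
- rewrite f1 e2 f3 e4 f5 e6.
  transitivity (2 * (yc v1 + zc v2 + yc v3 + zc v4 + yc v5 + zc v6)
    - (t1%:R + t2%:R + t3%:R + t4%:R + t5%:R + t6%:R)); first by ring.
  by rewrite t0 two0 mul0r subr0.
Qed.

(** Run through twice, a triangle is a closed 6-walk with an even number of negative edges. Each
    coincidence then equates the first coordinates of two adjacent vertices, which [copy_rel]
    forbids. *)
Lemma no_triangle t1 t2 t3 u v w :
  inc t1 u v -> inc t2 v w -> inc t3 w u -> False.
Proof.
move=> uv vw wu.
have even_t : ~~ odd (t1 + t2 + t3 + t1 + t2 + t3).
  by rewrite !oddD; case: (odd t1); case: (odd t2); case: (odd t3).
have /= := closed_walk6 uv vw wu uv vw wu even_t.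
have xuv := inc_xcN uv; have xvw := inc_xcN vw; have xwu := inc_xcN wu.
by case=> [[/esym/xwu]|[/esym/xuv]|[[/esym/xwu]|[/esym/xvw]|[/xuv]]].
Qed.

Lemma no_even_hexagon t1 t2 t3 t4 t5 t6 v1 v2 v3 v4 v5 v6 :
  inc t1 v1 v2 -> inc t2 v2 v3 -> inc t3 v3 v4 ->
  inc t4 v4 v5 -> inc t5 v5 v6 -> inc t6 v6 v1 ->
  uniq [:: v1; v2; v3; v4; v5; v6] ->
  odd (t1 + t2 + t3 + t4 + t5 + t6).
Proof.
move=> h1 h2 h3 h4 h5 h6 uniq_v; apply/negPn/negP => even_t.
(* For the stars: three distinct vertices over one first coordinate, any two with a common
   neighbour, would need three different copies. The path cases below give two disjoint copies of
   the middle edge. *)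
have three (b1 b2 b3 : bool) : b1 != b2 -> b2 != b3 -> b3 != b1 -> False.
  by case: b1; case: b2; case: b3.
move: uniq_v; rewrite /= !inE !negb_or -!andbA.
case/and5P=> _ /eqP n13 _ /eqP n15 /and5P[_ _ /eqP n24 _].
case/and5P=> /eqP n26 _ /eqP n35 _ /and4P[_ /eqP n46 _ _].
have /= [[x13 x35]|[x24 x46]|[[x46 x13]|[x35 x26]|[x15 x24]]] :=
  closed_walk6 h1 h2 h3 h4 h5 h6 even_t.
- apply: (three _ _ _ (common_neighbour h1 h2 x13 n13)
    (common_neighbour h3 h4 x35 n35)).
  by apply: (common_neighbour h5 h6); [rewrite -x35 -x13|exact/nesym].
- apply: (three _ _ _ (common_neighbour h2 h3 x24 n24)
    (common_neighbour h4 h5 x46 n46)).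
  by apply: (common_neighbour h6 h1); [rewrite -x46 -x24|exact/nesym].
- rewrite inc_sym in h6.
  apply: (no_two_disjoint_copies h6 h3 x13 (esym x46)).
    exact: common_neighbour h1 h2 x13 n13.
  by rewrite eq_sym; exact: common_neighbour h4 h5 x46 n46.
- rewrite inc_sym in h2.
  apply: (no_two_disjoint_copies h2 h5 x35 x26).
    exact: common_neighbour h3 h4 x35 n35.
  rewrite inc_sym in h2; rewrite eq_sym.
  by apply: (common_neighbour h6 h1); [|exact/nesym].
- rewrite inc_sym in h4.
  apply: (no_two_disjoint_copies h1 h4 x15 x24).
    rewrite eq_sym; apply: (common_neighbour h5 h6); [by []|exact/nesym].
  exact: common_neighbour h2 h3 x24 n24.
Qed.

(** * Counting vertices and edges *)

Lemma sum_copies (f : F * bool -> nat) :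
  (\sum_(p : copy) f (val p)
   = \sum_a (f (a, false) + (a \in A) * f (a, true)))%N.
Proof.
rewrite -(big_sub [pred p : F * bool | p.2 ==> (p.1 \in A)]).
rewrite big_mkcond /=.
transitivity (\sum_a \sum_i (if i ==> (a \in A) then f (a, i) else 0))%N.
  by rewrite pair_bigA; apply: eq_bigr => -[].
apply: eq_bigr => a _; rewrite big_bool /= addnC.
by case: (a \in A); rewrite ?mul1n ?mul0n.
Qed.

Lemma sum_distinct (B : {set F}) :
  (\sum_(a in B) \sum_(x in B) (a != x) = #|B| * #|B|.-1)%N.
Proof.
rewrite -sum_nat_const; apply: eq_bigr => a aB.
rewrite (cardsD1 a B) aB /= -sum1_card [LHS]big_mkcond [RHS]big_mkcond /=.
apply: eq_bigr => x _; rewrite !inE eq_sym andbC.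
by case: (x \in B); case: (x == a).
Qed.

Lemma card_copy : #|{: copy}| = (#|F| + #|A|)%N.
Proof.
transitivity (\sum_(p : copy) 1)%N; first by rewrite sum1_card.
apply: etrans (sum_copies (fun=> 1%N)) _.
rewrite big_split sum1_card /=; congr addn.
by rewrite -sum1_card [RHS]big_mkcond; apply: eq_bigr => a _; case: (a \in A).
Qed.

(** An ordered pair of distinct first coordinates carries two related pairs of copies, except that
    it carries only one when neither coordinate is doubled. *)
Lemma copy_rel_count :
  (\sum_(p : copy) \sum_(r : copy) copy_rel (val p) (val r)
     + #|~: A| * #|~: A|.-1 = 2 * (#|F| * #|F|.-1))%N.
Proof.
rewrite -sum_distinct -cardsT -sum_distinct big_distrr /=.
rewrite [X in (_ + X)%N]big_mkcond /=.
rewrite (sum_copies (fun p => \sum_(r : copy) copy_rel p (val r)))%N.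
rewrite -big_split; apply: eq_big => [a|a _]; first by rewrite inE.
rewrite !(sum_copies (fun r => copy_rel _ r)) /= big_distrr -big_split.
rewrite big_distrr /=.
rewrite (_ : (if _ then _ else _) = \sum_x (a \notin A) * (x \notin A) * (a != x))%N.
  rewrite -big_split; apply: eq_big => [x|x _]; first by rewrite inE.
  rewrite /= /copy_rel /=; case: (a != x); last by rewrite !muln0.
  by case: (a \in A); case: (x \in A); case: ifP.
rewrite inE; case: (a \notin A); last by rewrite big1 // => x _; rewrite mul0n.
rewrite big_mkcond; apply: eq_bigr => x _; rewrite inE.
by case: (x \notin A); rewrite ?mul1n.
Qed.

(** Each copy related to that of [v] carries exactly one neighbour of [v]: [z r] is its last
    coordinate before translation, and [t r] tells whether a translation is needed to reach
    [half]. *)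
Lemma sum_inc v :
  (\sum_(w | inc false v w || inc true v w) 1
   = \sum_(r : copy) copy_rel (val v.1.1) (val r))%N.
Proof.
pose z (r : copy) := yc v + tau (xc v) * (val r).1.
pose t (r : copy) := ~~ below_succ (z r).
(* The default [v.2] of [insubd] never occurs, because the shifted value lies in [half]. *)
pose n (r : copy) : vert :=
  (r, zc v + xc v * tau (val r).1 + (t r)%:R, insubd v.2 (z r + (t r)%:R)).
have n_inj : injective n by move=> r r' [].
have yn r : yc (n r) = zc v + xc v * tau (val r).1 + (t r)%:R by [].
have zn r : zc (n r) = z r + (t r)%:R.
  by rewrite /zc insubdK // -topredE /= below_succ_bool addNb addbb.
rewrite [RHS](_ : _ = #|[pred r : copy | copy_rel (val v.1.1) (val r)]|); last first.
  by rewrite -sum1_card [RHS]big_mkcond; apply: eq_bigr => r _; rewrite inE; case: copy_rel.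
rewrite sum1_card -(fintype.card_image n_inj); apply: eq_card => w.
have add2 (x y : F) : x + (x + y) = y.
  by rewrite addrA -mulr2n -mulr_natl two0 mul0r add0r.
apply/idP/fintype.imageP => [vw|[r r_ok ->]].
  have [t' {}vw] : exists t', inc t' v w.
    by case/orP: vw => ?; [exists false|exists true].
  case/and3P: vw => vw /eqP ey /eqP ez; exists w.1.1 => //.
  have zw : zc w = z w.1.1 + t'%:R by rewrite -addrA -ez add2.
  have tE : t' = t w.1.1.
    have := valP w.2; rewrite -/(zc w) zw below_succ_bool /t.
    by case: (t'); case: below_succ.
  apply: vert_eq => //; last by rewrite zn zw tE.
  by rewrite yn -tE -addrA -ey add2.
have : inc (t r) v (n r).
  by rewrite /inc zn yn /z -!addrA !add2 !eqxx !andbT; exact: r_ok.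
by rewrite -topredE /=; case: (t r) => ->; rewrite ?orbT.
Qed.

Lemma polarity_signed_graph :
  exists G : signed_graph vert,
    [/\ C3neg_C6pos_free G,
        (2 * num_vertices G = #|F| ^ 2 * (#|F| + #|A|))%N &
        (4 * num_edges G + #|F| ^ 2 * (#|~: A| * #|~: A|.-1)
           = 2 * (#|F| ^ 3 * #|F|.-1))%N].
Proof.
have [G [adjG signG edgesG]] := signed_graph_of_rel inc_sym inc_irr inc_disj.
have adj_inc v w : adj G v w ->
    exists2 t, inc t v w & sigma G [set v; w]%SET = (-1) ^+ t.
  rewrite adjG => /orP[] vw; [exists false|exists true] => //; exact: signG.
exists G; split.
- apply/andP; split; apply/negP => /existsP[[s]].
    case: s => [|v1 [|v2 [|v3 [|//]]]] //= sz /and3P[+ _ _].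
    case/and4P=> /adj_inc[t1 h1 _] /adj_inc[t2 h2 _] /adj_inc[t3 h3 _] _.
    exact: no_triangle h1 h2 h3.
  case: s => [|v1 [|v2 [|v3 [|v4 [|v5 [|v6 [|//]]]]]]] //= sz.
  move=> /and3P[+ uniq_v].
  case/and5P=> /adj_inc[t1 h1 s1] /adj_inc[t2 h2 s2] /adj_inc[t3 h3 s3].
  move=> /adj_inc[t4 h4 s4] /and3P[/adj_inc[t5 h5 s5] /adj_inc[t6 h6 s6] _].
  have := no_even_hexagon h1 h2 h3 h4 h5 h6 uniq_v.
  have -> : cycle_sign G [:: v1; v2; v3; v4; v5; v6]
      = (-1) ^+ (t1 + t2 + t3 + t4 + t5 + t6).
    rewrite /cycle_sign !big_cons big_nil.
    move: uniq_v; rewrite /= !inE !negb_or -!andbA.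
    case/and5P=> n12 n13 n14 n15 /and5P[n16 n23 n24 n25].
    case/and5P=> n26 n34 n35 n36 /and4P[n45 n46 n56 _].
    (* Distinctness of the six vertices evaluates every [next] in the sign product. *)
    rewrite !eqxx.
    rewrite !(ifN_eqC _ _ n12, ifN_eqC _ _ n13, ifN_eqC _ _ n14,
      ifN_eqC _ _ n15, ifN_eqC _ _ n16, ifN_eqC _ _ n23, ifN_eqC _ _ n24,
      ifN_eqC _ _ n25, ifN_eqC _ _ n26, ifN_eqC _ _ n34, ifN_eqC _ _ n35,
      ifN_eqC _ _ n36, ifN_eqC _ _ n45, ifN_eqC _ _ n46, ifN_eqC _ _ n56).
    by rewrite s1 s2 s3 s4 s5 s6 mulr1 -!exprD !addnA.
  by rewrite -signr_odd => ->.
- have -> : num_vertices G = ((#|F| + #|A|) * #|F| * #|{: half}|)%N.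
    by rewrite /num_vertices !card_prod card_copy.
  rewrite -mulnn -{3}card_half -muln2; lia.
- have := edgesG; under eq_bigr => v _ do rewrite sum_inc.
  (* The degree of a vertex depends only on its copy, so the other two coordinates contribute a
     constant factor. *)
  rewrite (_ : \sum_v _ = #|F| * #|{: half}|
      * \sum_(p : copy) \sum_(r : copy) copy_rel (val p) (val r))%N; last first.
    rewrite -(pair_bigA _ (fun (p : copy * F) (c : half) =>
      \sum_(r : copy) copy_rel (val p.1) (val r)))%N /=.
    rewrite exchange_big sum_nat_const.
    rewrite -(pair_bigA _ (fun (p : copy) (c : F) =>
      \sum_(r : copy) copy_rel (val p) (val r)))%N /=.
    rewrite exchange_big sum_nat_const mulnA.
    by congr (_ * _)%N; rewrite mulnC.
  move: (\sum_p _)%N copy_rel_count => C countE edgesE.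
  have -> : (4 * num_edges G = #|F| ^ 2 * C)%N.
    have := card_half; rewrite -mulnn; nia.
  by rewrite -mulnDr countE !expnS; move: #|F|.-1 => n; lia.
Qed.

End Polarity.

(** * The construction over the field of order 2^(2j+1) *)

Lemma exists_polarity_graph j m (q := (2 ^ (2 * j + 1))%N) : (m <= q)%N ->
  exists (V : finType) (G : signed_graph V),
    [/\ C3neg_C6pos_free G,
        (2 * num_vertices G = q ^ 2 * (q + m))%N &
        (4 * num_edges G + q ^ 2 * ((q - m) * (q - m).-1)
           = 2 * (q ^ 3 * q.-1))%N].
Proof.
move=> m_le_q.
have k_gt0 : (0 < 2 * j + 1)%N by rewrite addn1.
have [F F2 cardF] := @pPrimePowerField 2 (2 * j + 1) isT k_gt0.
rewrite -/q in cardF; rewrite -cardF in m_le_q *.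
pose A : {set F} := [set enum_val (widen_ord m_le_q i) | i : 'I_m]%SET.
have cardA : #|A| = m.
  rewrite card_imset ?card_ord // => i i' /enum_val_inj/(congr1 val) /= e.
  exact: val_inj.
have cardCA : #|~: A| = (#|F| - m)%N by rewrite -cardA -(cardsC A) addKn.
(* Applied twice, this raises to the power 2^(2j+2) = 2q, and x^q = x in [F], which leaves the
   square. *)
pose tau (x : F) := x ^+ (2 ^ j.+1).
have tauD : {morph tau : x y / x + y}.
  by move=> x y; rewrite /tau exprDn_pchar // pnatX pnatE // F2.
have tauM : {morph tau : x y / x * y} by move=> x y; rewrite /tau exprMn.
have tauK x : tau (tau x) = x ^+ 2.
  rewrite /tau -exprM -expnD (_ : j.+1 + j.+1 = (2 * j + 1).+1)%N; last by lia.
  by rewrite expnS mulnC exprM -/q -cardF expf_card.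
have [G [freeG vertG edgesG]] := polarity_signed_graph F2 tauD tauM tauK A.
exists _, G; split=> //; last by rewrite -cardCA.
by rewrite -cardA.
Qed.

(** * Comparison with the extremal number *)

(** [R6] ranges over graphs on ordinals only, so the graphs constructed have to be carried over to
    such vertex sets. *)
Lemma relabel_signed_graph (V W : finType) (h : W -> V) (G : signed_graph V) :
  bijective h -> C3neg_C6pos_free G ->
  exists2 H : signed_graph W, C3neg_C6pos_free H & num_edges H = num_edges G.
Proof.
move=> h_bij freeG; have h_inj := bij_inj h_bij.
pose E : {set {set W}} := [set e : {set W} | (h @: e)%SET \in edges G]%SET.
pose s : {ffun {set W} -> bool} := [ffun e : {set W} => G.2 (h @: e)%SET].
have E_simple : [forall e in E, #|e| == 2].
  apply/forall_inP => e; rewrite inE -(card_imset _ h_inj) => he.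
  by have /forall_inP/(_ _ he) := sg_simple G.
pose H := @SignedGraph W (E, s) E_simple.
have h2 x y : (h @: [set x; y] = [set h x; h y])%SET.
  by rewrite imsetU1 imset_set1.
have adjE x y : adj H x y = adj G (h x) (h y) by rewrite /adj inE h2.
have signE x y : sigma H [set x; y]%SET = sigma G [set h x; h y]%SET.
  by rewrite /sigma /= ffunE h2.
have cycleE k t : has_signed_cycle H k t -> has_signed_cycle G k t.
  case/existsP=> c /and3P[c_cycle c_uniq c_sign]; apply/existsP.
  exists (map_tuple h c); rewrite cycle_map map_inj_uniq // c_uniq.
  rewrite -(eq_cycle (e := adj H)) ?c_cycle //=.
  rewrite -(eqP c_sign) /cycle_sign big_map; apply/eqP/eq_bigr => x _.
  by rewrite next_map // signE.
exists H.
  by case/andP: freeG => f3 f6; rewrite /C3neg_C6pos_free !(contra (@cycleE _ _)).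
rewrite /num_edges -(card_imset (edges H) (imset_inj h_inj)).
congr #|pred_of_set _|; apply/setP => e; apply/imsetP/idP => [[e' + ->]|eG].
  by rewrite inE.
have [g gK hK] := h_bij.
have eE : e = [set h x | x in [set g y | y in e]]%SET.
  by rewrite -imset_comp (eq_imset (g := id)) ?imset_id.
by exists [set g y | y in e]%SET => //; rewrite inE -eE.
Qed.

Lemma num_edges_le_R6 (V : finType) (G : signed_graph V) :
  C3neg_C6pos_free G -> (num_edges G <= R6 (num_vertices G))%N.
Proof.
move=> /(relabel_signed_graph (@enum_val_bij V))[H freeH <-].
rewrite /R6; exact: (@leq_bigmax_cond _ (fun H => C3neg_C6pos_free H)
  (fun H => num_edges H) H freeH).
Qed.

(** * Asymptotics and the upper limit *)

Local Open Scope classical_set_scope.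

Lemma polarity_graph_asymptotics (R : realType) (alpha : R) :
  let q (j : nat) : nat := (2 ^ (2 * j + 1))%N in
  let N (j : nat) : R := ((q j) ^ 3)%N%:R in
  0 < alpha < 1 ->
  exists (V : nat -> finType) (Q : forall j : nat, signed_graph (V j))
         (eps1 eps2 : nat -> R),
    [/\ eps1 j @[j --> \oo] --> 0,
        eps2 j @[j --> \oo] --> 0 &
        forall j : nat,
          [/\ C3neg_C6pos_free (Q j),
              (num_vertices (Q j))%:R = ((1 + alpha) / 2 + eps1 j) * N j &
              (num_edges (Q j))%:R
                = ((1 + 2 * alpha - alpha ^+ 2) / 4 + eps2 j)
                    * N j `^ (4 / 3)]].
Proof.
move=> q N /andP[alpha_gt0 alpha_lt1].
have q_gt0 j : (0 < q j)%N by rewrite expn_gt0.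
have qR_gt0 j : 0 < (q j)%:R :> R by rewrite ltr0n.
pose m j := Num.truncn (alpha * (q j)%:R).
have m_itv j : (m j)%:R <= alpha * (q j)%:R < (m j).+1%:R.
  by apply: truncn_itv; rewrite mulr_ge0 // ltW.
have m_le_q j : (m j <= q j)%N.
  have /andP[+ _] := m_itv j; rewrite -(ler_nat R) => /le_trans; apply.
  by rewrite ler_piMl // ltW.
pose u j : R := (q j)%:R^-1; pose a j := (m j)%:R * u j.
have u_cvg : u j @[j --> \oo] --> 0.
  apply: (squeeze_cvgr (f := fun=> 0) (h := harmonic)); last 2 first.
  - exact: cvg_cst.
  - exact: cvg_harmonic.
  apply: nearW => j; rewrite /u invr_ge0 ler0n /= lef_pV2 ?posrE ?ltr0n //.
  rewrite ler_nat; apply: leq_trans (ltn_expl j (isT : 1 < 2)%N) _.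
  by rewrite /q leq_exp2l //; lia.
have a_cvg : a j @[j --> \oo] --> alpha.
  apply: (squeeze_cvgr (f := fun j => alpha - u j) (h := fun=> alpha)); last 2 first.
  - by rewrite -[X in _ --> X]subr0; apply: cvgB => //; exact: cvg_cst.
  - exact: cvg_cst.
  apply: nearW => j; have /andP[m_le m_gt] := m_itv j.
  rewrite /a /u ler_pdivrMr // m_le andbT ler_pdivlMr // mulrBl mulVf ?gt_eqF //.
  by rewrite lerBlDr natr1 ltW.
pose X j := cid (exists_polarity_graph (m_le_q j)).
pose V j := projT1 (X j); pose Y j := cid (projT2 (X j)).
pose Q j : signed_graph (V j) := projT1 (Y j).
pose c : R := (1 + 2 * alpha - alpha ^+ 2) / 4.
(* With a = m/q and u = 1/q, the exact counts are v = q^3 (1 + a)/2 and e = q^4 (2(1 - u) - (1 -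
   a)(1 - a - u))/4. The error terms are the differences from the limits at a = alpha, u = 0. *)
exists V, Q, (fun j => (a j - alpha) / 2),
  (fun j => (2 * (1 - u j) - (1 - a j) * (1 - a j - u j)) / 4 - c); split.
- rewrite -(mul0r 2^-1) -(subrr alpha); apply: cvgM; last exact: cvg_cst.
  by apply: cvgB => //; exact: cvg_cst.
- have -> : 0 = (2 * (1 - 0) - (1 - alpha) * (1 - alpha - 0)) / 4 - c.
    by rewrite /c; field.
  have c1 : (1 : R) @[_ --> \oo : set_system nat] --> (1 : R) by exact: cvg_cst.
  apply: cvgB; last exact: cvg_cst.
  apply: cvgM; last exact: cvg_cst.
  apply: cvgB; first by apply: cvgM; [exact: cvg_cst|exact: cvgB].
  by apply: cvgM; [exact: cvgB|apply: cvgB => //; exact: cvgB].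
- move=> j; have [freeQ /(congr1 (fun n => n%:R : R)) vertQ edgesQ] := projT2 (Y j).
  have qN0 : (q j)%:R != 0 :> R by rewrite gt_eqF.
  have qX k : ((q j) ^ k)%N%:R = (q j)%:R ^+ k :> R by rewrite natrX.
  split=> //.
    apply: (mulfI (_ : 2 != 0 :> R)); first by rewrite pnatr_eq0.
    rewrite -natrM [LHS]vertQ -/(q j) /N natrM !qX natrD /a /u.
    by field.
  have -> : N j `^ (4 / 3) = (q j)%:R ^+ 4.
    rewrite /N qX -powR_mulrn // -powRrM -powR_mulrn //.
    by congr (_ `^ _); field.
  have s_sub : (q j - m j)%:R = (q j)%:R - (m j)%:R :> R by rewrite natrB.
  have pred_mul n : (n * n.-1)%:R = n%:R * (n%:R - 1) :> R.
    by case: n => [|n]; rewrite ?mul0r // natrM -natr1 addrK.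
  have q_pred : (q j).-1%:R = (q j)%:R - 1 :> R.
    by rewrite -[in RHS](prednK (q_gt0 j)) -natr1 addrK.
  have edgesR : 4 * (num_edges (Q j))%:R
      + (q j)%:R ^+ 2 * (((q j)%:R - (m j)%:R) * ((q j)%:R - (m j)%:R - 1))
      = 2 * ((q j)%:R ^+ 3 * ((q j)%:R - 1)) :> R.
    by rewrite -s_sub -pred_mul -q_pred -!qX -!natrM -natrD edgesQ.
  apply: (mulfI (_ : 4 != 0 :> R)); first by rewrite pnatr_eq0.
  apply: etrans (canRL (addrK _) edgesR) _; rewrite /c /a /u.
  by field.
Qed.

(** The upper limit is the infimum of suprema over neighbourhoods of infinity. Each of these
    contains some [k j] with u(k j) >= e j > l - d. *)
Lemma le_limn_esup_subseq (R : realType) (u e : nat -> R) (k : nat -> nat) (l : R) :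
  (forall n, \forall j \near \oo, (n <= k j)%N) -> e j @[j --> \oo] --> l ->
  (\forall j \near \oo, e j <= u (k j)) ->
  (l%:E <= limn_esup (fun n => (u n)%:E))%E.
Proof.
move=> k_infty e_cvg e_le; rewrite /limn_esup /limf_esup.
apply/le_ereal_inf_tmp => _ [S [n _ nS] <-]; apply/lee_addgt0Pr => d d_gt0.
have [j [kj ej lj]] : exists j, [/\ (n <= k j)%N, e j <= u (k j) & l < e j + d].
  suff : \forall j \near \oo, [/\ (n <= k j)%N, e j <= u (k j) & l < e j + d].
    by case=> j _ /(_ j (leqnn j)); exists j.
  near=> j; split; [by near: j; exact: k_infty|by near: j|].
  rewrite -ltrBlDr; near: j; apply: (cvgr_gt _ e_cvg).
  by rewrite ltrBlDr ltrDl.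
apply: (@le_trans _ _ ((u (k j))%:E + d%:E)%E).
  by rewrite -EFinD lee_fin; apply: (le_trans (ltW lj)); rewrite lerD2r.
by rewrite leeD2r //; apply: ereal_sup_ubound; exists (k j) => //; exact: nS.
Unshelve. all: by end_near.
Qed.

Lemma continuous_powRr (R : realType) (r x : R) :
  0 < x -> {for x, continuous (fun y => y `^ r)}.
Proof.
move=> x_gt0; apply: differentiable_continuous; apply/derivable1_diffP.
by apply: derivable_powR; rewrite in_itv /= x_gt0.
Qed.

(** At n = v(Q_j) the extremal number is at least e(Q_j). The powers of N cancel in e/v^(4/3), which
    tends to the left side. *)
Lemma le_limn_esup_R6 (R : realType) (alpha : R) : 0 < alpha < 1 ->
  (((1 + 2 * alpha - alpha ^+ 2) / 4 / ((1 + alpha) / 2) `^ (4 / 3))%:E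
     <= limn_esup (fun n : nat => ((R6 n)%:R / n%:R `^ (4 / 3))%:E))%E.
Proof.
move=> alpha01; have [V [Q [eps1 [eps2 [eps1_cvg eps2_cvg QP]]]]] :=
  polarity_graph_asymptotics alpha01.
set C := (1 + 2 * alpha - alpha ^+ 2) / 4; set D := (1 + alpha) / 2.
have D_gt0 : 0 < D by rewrite /D; case/andP: alpha01 => ? _; lra.
pose N j : R := ((2 ^ (2 * j + 1)) ^ 3)%N%:R.
have N_ge j : j%:R <= N j.
  rewrite /N -expnM ler_nat; apply/ltnW; apply: leq_trans (ltn_expl j (isT : 1 < 2)%N) _.
  by rewrite leq_exp2l //; lia.
have N_gt0 j : 0 < N j by rewrite ltr0n !expn_gt0.
(* Staying above D/2 makes the vertex numbers tend to infinity and keeps the base of the power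
   positive. *)
have D_near : \forall j \near \oo, D / 2 < D + eps1 j.
  have : (D + eps1 j) @[j --> \oo] --> D.
    by rewrite -[X in _ --> X]addr0; apply: cvgD => //; exact: cvg_cst.
  by move=> /cvgr_gt; apply; lra.
apply: (@le_limn_esup_subseq _ (fun n => (R6 n)%:R / n%:R `^ (4 / 3))
  (fun j => (C + eps2 j) / (D + eps1 j) `^ (4 / 3))
  (fun j => num_vertices (Q j))).
- move=> n; near=> j; rewrite -(ler_nat R); have [_ -> _] := QP j.
  have D_j : D / 2 < D + eps1 j by near: j.
  have n_le : n%:R / (D / 2) <= N j.
    apply: le_trans (N_ge j); near: j; exact: nbhs_infty_ger.
  rewrite -/D -/(N j) -(divfK (_ : D / 2 != 0) n%:R) ?gt_eqF //; last by lra.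
  rewrite mulrC; apply: ler_pM => //; [lra| |exact: ltW].
  by rewrite divr_ge0 //; lra.
- apply: cvgM.
    by rewrite -[X in _ --> X]addr0; apply: cvgD => //; exact: cvg_cst.
  apply: cvgV; first by rewrite gt_eqF // powR_gt0.
  apply: (continuous_cvg _ (continuous_powRr D_gt0)).
  by rewrite -[X in _ --> X]addr0; apply: cvgD => //; exact: cvg_cst.
- near=> j; have D_j : D / 2 < D + eps1 j by near: j.
  have [freeQ vQ eQ] := QP j; rewrite vQ -/D -/(N j).
  have -> : (C + eps2 j) / (D + eps1 j) `^ (4 / 3)
      = (num_edges (Q j))%:R / ((D + eps1 j) * N j) `^ (4 / 3).
    rewrite eQ -/C -/(N j) powRM; [|lra|exact: ltW].
    by rewrite invfM mulrACA divff ?mulr1 // gt_eqF // powR_gt0.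
  by rewrite ler_wpM2r ?invr_ge0 ?powR_ge0 // ler_nat num_edges_le_R6.
Unshelve. all: by end_near.
Qed.

(** * Numerical values of the constants *)

(** The cubes of both constants are affine in sqrt 5, so twelve decimals here settle nine decimals
    there by linear arithmetic. *)
Lemma sqrt5_bounds (R : rcfType) :
  (2 + 236 / 10 ^+ 3 + 67 / 10 ^+ 6 + 977 / 10 ^+ 9 + 499 / 10 ^+ 12 : R)
    < Num.sqrt (5 : R)
    < 2 + 236 / 10 ^+ 3 + 67 / 10 ^+ 6 + 977 / 10 ^+ 9 + 500 / 10 ^+ 12.
Proof.
have s_ge0 : 0 <= Num.sqrt 5 :> R by exact: sqrtr_ge0.
have s2 : Num.sqrt 5 ^+ 2 = 5 :> R by rewrite sqr_sqrtr.
have lt_sqr (x y : R) : 0 <= y -> x ^+ 2 < y ^+ 2 -> x < y.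
  move=> y_ge0; apply: contraTT; rewrite -!leNgt => yx; nra.
apply/andP; split; apply: lt_sqr; rewrite ?s2 /=; lra.
Qed.

Lemma c6_ge0 (R : realType) : 0 <= c6 R.
Proof.
have /andP[s_gt _] := sqrt5_bounds R.
by rewrite /c6 divr_ge0 ?powR_ge0 //; lra.
Qed.

(** Cubing clears the exponent 4/3 and leaves 27 (s - 2)^3 / (s - 1)^4 with s = sqrt 5. Both sides
    of the cross-multiplied identity are expanded and reduced by s^2 = 5. *)
Lemma c6_cube (R : realType) : c6 R ^+ 3 = 27 * (5 * Num.sqrt 5 - 11) / 32.
Proof.
have /andP[s_gt _] := sqrt5_bounds R.
have s2 : Num.sqrt 5 ^+ 2 = 5 :> R by rewrite sqr_sqrtr.
have s1 : 0 < Num.sqrt 5 - 1 :> R by lra.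
have y3 : ((Num.sqrt 5 - 1) `^ (4 / 3)) ^+ 3 = (Num.sqrt 5 - 1) ^+ 4 :> R.
  rewrite -powR_mulrn ?powR_ge0 // -powRrM -powR_mulrn ?ltW //.
  by congr (_ `^ _); field.
rewrite /c6 expr_div_n y3; apply: (canLR (mulfK _)); first by rewrite expf_neq0 ?gt_eqF.
move: (Num.sqrt 5) s2 => s s2.
have s3 : s ^+ 3 = 5 * s by rewrite exprS s2 mulrC.
have s4 : s ^+ 4 = 25 by rewrite (exprM s 2 2) s2; ring.
have s5 : s ^+ 5 = 25 * s by rewrite exprS s4 mulrC.
transitivity (27 * (s ^+ 3 - 6 * s ^+ 2 + 12 * s - 8)); first by ring.
transitivity (27 / 32 * (5 * s ^+ 5 - 31 * s ^+ 4 + 74 * s ^+ 3 - 86 * s ^+ 2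
  + 49 * s - 11)).
  by rewrite s5 s4 s3 s2; field.
by field.
Qed.

Lemma rounds_to9_cube (R : realType) (x : R) (a b c : nat)
    (y : R := a%:R / 10 ^+ 3 + b%:R / 10 ^+ 6 + c%:R / 10 ^+ 9)
    (d : R := (10 ^+ 9)^-1 / 2) :
  0 <= x -> 0 <= y - d -> (y - d) ^+ 3 < x ^+ 3 < (y + d) ^+ 3 ->
  rounds_to9 x a b c.
Proof.
move=> x_ge0 y_ge /andP[lo hi]; rewrite /rounds_to9 -/y -/d.
have d_ge0 : 0 <= d by rewrite divr_ge0 ?invr_ge0 ?exprn_ge0.
rewrite ltr_distl; apply/andP; split; rewrite -(@ltr_pXn2r _ 3) ?nnegrE //.
by apply: le_trans y_ge _; lra.
Qed.

(** * The lower bound at the optimal density *)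

Unset Implicit Arguments.

Theorem theorem5p4 (R : realType) :
  let q (j : nat) : nat := (2 ^ (2 * j + 1))%N in
  let N (j : nat) : R := ((q j) ^ 3)%N%:R in
  [/\ forall alpha : R, 0 < alpha < 1 ->
        exists (V : nat -> finType) (Q : forall j : nat, signed_graph (V j))
               (eps1 eps2 : nat -> R),
          [/\ eps1 j @[j --> \oo] --> 0,
              eps2 j @[j --> \oo] --> 0 &
              forall j : nat,
                [/\ C3neg_C6pos_free (Q j),
                    (num_vertices (Q j))%:R
                      = ((1 + alpha) / 2 + eps1 j) * N j &
                    (num_edges (Q j))%:R
                      = ((1 + 2 * alpha - alpha ^+ 2) / 4 + eps2 j)
                          * N j `^ (4 / 3)]],
      ((2 `^ (1 / 3) * c6 R)%:E
         <= limn_esup (fun n : nat => ((R6 n)%:R / n%:R `^ (4 / 3))%:E))%E,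
      rounds_to9 (2 `^ (1 / 3) * c6 R) 672 633 550 &
      rounds_to9 (c6 R) 533 869 602].
Proof.
move=> q N; have /andP[s_gt s_lt] := sqrt5_bounds R; split.
- by move=> alpha; exact: polarity_graph_asymptotics.
(* The derivative of (1 + 2a - a^2)/(1 + a)^(4/3) vanishes where a^2 + 4a - 1 = 0, whose positive
   root is sqrt 5 - 2. *)
- have alpha01 : 0 < Num.sqrt (5 : R) - 2 < 1 by lra.
  apply: le_trans (le_limn_esup_R6 alpha01); rewrite lee_fin le_eqVlt; apply/orP; left.
  have s1_gt0 : 0 < Num.sqrt 5 - 1 :> R by lra.
  have s2 : Num.sqrt 5 ^+ 2 = 5 :> R by rewrite sqr_sqrtr.
  rewrite (_ : 1 + (Num.sqrt 5 - 2) = Num.sqrt 5 - 1 :> R); last by ring.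
  have two_pow : 2^-1 `^ (4 / 3) = (2 * 2 `^ (1 / 3))^-1 :> R.
    rewrite -(@powR_inv1 _ 2) // -powRrM (_ : -1 * (4 / 3) = - (1 + 1 / 3)); last by field.
    by rewrite powRN powRD ?pnatr_eq0 ?implybT // powRr1.
  rewrite powRM ?invr_ge0 ?ltW // two_pow.
  (* The bracket 5 - s^2 is split off so that the numerator becomes a multiple of s - 2, as in
     [c6]. *)
  rewrite (_ : 1 + 2 * (Num.sqrt 5 - 2) - (Num.sqrt 5 - 2) ^+ 2
    = 6 * (Num.sqrt 5 - 2) + (5 - Num.sqrt 5 ^+ 2) :> R); last by ring.
  rewrite s2 subrr addr0.
  have p0 : (Num.sqrt 5 - 1) `^ (4 / 3) != 0 :> R by rewrite gt_eqF ?powR_gt0.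
  have t0 : 2 `^ (1 / 3) != 0 :> R by rewrite gt_eqF ?powR_gt0.
  by apply/eqP; rewrite /c6; field; rewrite p0 t0.
- apply: rounds_to9_cube; first by rewrite mulr_ge0 ?powR_ge0 ?c6_ge0.
    by lra.
  have -> : (2 `^ (1 / 3) * c6 R) ^+ 3 = 27 * (5 * Num.sqrt 5 - 11) / 16.
    have root2 : (2 `^ (1 / 3)) ^+ 3 = 2 :> R.
      rewrite -powR_mulrn ?powR_ge0 // -powRrM -[RHS]powRr1 //.
      by congr (_ `^ _); field.
    by rewrite exprMn c6_cube root2; field.
  by lra.
- apply: rounds_to9_cube; [exact: c6_ge0|lra|].
  by rewrite c6_cube; lra.
Qed.
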